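(* Let $Y$ be a real vector space, $A\subseteq Y$ nonempty, $k\in Y\setminus\{0\}$ and $B\subseteq Y$. (1) If $A-B\subseteq A$, then $\varphi_{A,k}$ is $B$-monotone. (2) If $k\in-0^+A$, $A$ is $k$-directionally closed and $A-B\subseteq A+\mathbb{R}k$, then: $\varphi_{A,k}$ is $B$-monotone if and only if $A-B\subseteq A$. (3) If $A$ is $k$-directionally closed and $\varphi_{A,k}$ is finite-valued on $F\subseteq Y$, then: $A-(B\setminus\{0\})\subseteq\operatorname{core}A$ implies that $\varphi_{A,k}$ is strictly $B$-monotone on $F$. (4) If $A-\mathbb{R}_>k\subseteq\operatorname{core}A$ and $A-B\subseteq A+\mathbb{R}k$, then: if $\varphi_{A,k}$ is strictly $B$-monotone, then $A-(B\setminus\{0\})\subseteq\operatorname{core}A$. (5) Suppose that $\varphi_{A,k}$ is finite-valued on $F\subseteq Y$. If $A-B\subseteq A$, then $\varphi_{A,k}$ is strictly $(\operatorname{core}B)$-monotone on $F$.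
   Context: Let $\nu$ be a symbol not in $\overline{\mathbb{R}}=\mathbb{R}\cup\{-\infty,+\infty\}$, not comparable with real numbers, and $\inf\emptyset:=\nu$. For nonempty $A\subseteq Y$, $k\in Y\setminus\{0\}$, $\varphi_{A,k}:Y\to\overline{\mathbb{R}}\cup\{\nu\}$ is $\varphi_{A,k}(y):=\inf\{t\in\mathbb{R}\mid y\in A+tk\}$ ($-\infty$ if unbounded below); $\operatorname{dom}\varphi_{A,k}=\{y\in Y\mid\varphi_{A,k}(y)\in\mathbb{R}\cup\{-\infty\}\}$. ''Finite-valued on $F$'' means $\varphi_{A,k}(y)\in\mathbb{R}$ for all $y\in F$. For $B\subseteq Y$ and $F\subseteq\operatorname{dom}\varphi$, $\varphi$ is $B$-monotone on $F$ iff $y^1,y^2\in F$ and $y^2-y^1\in B$ imply $\varphi(y^1)\le\varphi(y^2)$; strictly $B$-monotone on $F$ iff $y^1,y^2\in F$ and $y^2-y^1\in B\setminus\{0\}$ imply $\varphi(y^1)<\varphi(y^2)$; (strictly) $B$-monotone iff it is (strictly) $B$-monotone on $\operatorname{dom}\varphi$. $\mathbb{R}_>=(0,\infty)$. $0^+A:=\{u\in Y\mid\forall a\in A\ \forall t\in[0,\infty):\ a+tu\in A\}$. $\operatorname{core}A$ is the algebraic interior: $a\in\operatorname{core}A$ iff $a\in A$ and for each $v\in Y$ there is $\varepsilon>0$ with $a+sv\in A$ for all $s\in[0,\varepsilon]$. $A$ is $k$-directionally closed if for every $y\in Y$: whenever there is a sequence $(t_n)$ of positive reals decreasing to $0$ with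 $y-t_nk\in A$ for all $n$, then $y\in A$. *)

(* Defs.v *)
From HB Require Import structures.
From mathcomp Require Import all_boot all_order all_algebra.
From mathcomp Require Import all_classical all_reals all_analysis.

Set Implicit Arguments.
Unset Strict Implicit.
Unset Printing Implicit Defensive.

Import Order.TTheory GRing.Theory Num.Theory.
Import numFieldNormedType.Exports.

Local Open Scope classical_set_scope.
Local Open Scope ring_scope.

(* Minkowski sum and difference (not the set-theoretic difference). *)
Definition minkowski_add (V : zmodType) (A B : set V) : set V :=
  [set a + b | a in A & b in B].

Definition minkowski_sub (V : zmodType) (A B : set V) : set V :=
  [set a - b | a in A & b in B].

Definition scaled_by (R : realType) (Y : lmodType R) (T : set R) (k : Y) :
    set Y :=
  [set t *: k | t in T].

(* The value space is [option (\bar R)]; [None] is the extra symbol nu. *)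
Definition inf_nu (R : realType) (S : set R) : option (\bar R) :=
  if `[< S = set0 >] then None else Some (ereal_inf (EFin @` S)).

(* nu is comparable with nothing. *)
Definition le_nu (R : realType) (x y : option (\bar R)) : Prop :=
  match x, y with
  | Some a, Some b => (a <= b)%E
  | _, _ => False
  end.

Definition lt_nu (R : realType) (x y : option (\bar R)) : Prop :=
  match x, y with
  | Some a, Some b => (a < b)%E
  | _, _ => False
  end.

Definition phi_fun (R : realType) (Y : lmodType R) (A : set Y) (k : Y) (y : Y) :
    option (\bar R) :=
  inf_nu [set t : R | minkowski_add A [set t *: k] y].

Definition nu_dom (R : realType) (Y : lmodType R) (f : Y -> option (\bar R)) :
    set Y :=
  [set y | (exists r : R, f y = Some r%:E) \/ f y = Some -oo%E].

Definition finite_valued_on (R : realType) (Y : lmodType R)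
    (f : Y -> option (\bar R)) (F : set Y) : Prop :=
  forall y, F y -> exists r : R, f y = Some r%:E.

(* The next two definitions are meant for F `<=` nu_dom f. *)
Definition B_monotone_on (R : realType) (Y : lmodType R)
    (f : Y -> option (\bar R)) (B F : set Y) : Prop :=
  forall y1 y2, F y1 -> F y2 -> B (y2 - y1) -> le_nu (f y1) (f y2).

Definition strictly_B_monotone_on (R : realType) (Y : lmodType R)
    (f : Y -> option (\bar R)) (B F : set Y) : Prop :=
  forall y1 y2, F y1 -> F y2 -> (B `\ 0) (y2 - y1) -> lt_nu (f y1) (f y2).

Definition B_monotone (R : realType) (Y : lmodType R)
    (f : Y -> option (\bar R)) (B : set Y) : Prop :=
  B_monotone_on f B (nu_dom f).

Definition strictly_B_monotone (R : realType) (Y : lmodType R)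
    (f : Y -> option (\bar R)) (B : set Y) : Prop :=
  strictly_B_monotone_on f B (nu_dom f).

Definition recession_cone (R : realType) (Y : lmodType R) (A : set Y) :
    set Y :=
  [set u | forall a, A a -> forall t : R, 0 <= t -> A (a + t *: u)].

Definition alg_core (R : realType) (Y : lmodType R) (A : set Y) : set Y :=
  [set a | A a /\ forall v : Y, exists2 e : R, 0 < e &
    forall s : R, 0 <= s <= e -> A (a + s *: v)].

Definition directionally_closed (R : realType) (Y : lmodType R) (k : Y)
    (A : set Y) : Prop :=
  forall y : Y,
    (exists t : R^nat,
      [/\ forall n, 0 < t n, decreasing_seq t, t @ \oo --> (0 : R)
        & forall n, A (y - t n *: k)]) ->
    A y.

(* Main.v *)
Require Import Defs.
From HB Require Import structures.
From mathcomp Require Import all_boot all_order all_algebra.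
From mathcomp Require Import all_classical all_reals all_analysis.

Set Implicit Arguments.
Unset Strict Implicit.
Unset Printing Implicit Defensive.

Import Order.TTheory GRing.Theory Num.Theory.
Import numFieldNormedType.Exports.

Local Open Scope classical_set_scope.
Local Open Scope ring_scope.

(** Everything takes place on the slice [levels A k y], which records where the
    line through [y] in direction [k] meets [A]: the value [phi y] is its
    infimum, and [y] lies in the domain exactly when the slice is nonempty.  Comparing values of [phi]
    at two points therefore reduces to comparing two slices.

    Monotonicity from set inclusions.  If [A - B `<=` A] and
    [y2 - y1 - s *: k] is in [B], then [t] in the slice of [y2] puts [t - s] in
    the slice of [y1], whence [phi y1 + s <= phi y2] ([phi_shift]).  The case
    [s = 0] is monotonicity; for [y2 - y1] in the core of [B] a positive [s] is
    available in the direction [- k], and finiteness of the values turns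
    the gain [s] into a strict inequality.  If instead [A - (B `\ 0)] falls
    in the core of [A], the positive gain comes from the core of [A]; there the
    infimum [r] of the slice of [y2] has to be attained, which is what
    directional closedness gives ([phi_attained]), and moving from
    [y1 - r *: k] a little in the direction [k] stays in [A].

    Set inclusions from monotonicity.  For [a] in [A] the slice of [a] contains
    [0], so [phi a <= 0], and monotonicity gives [phi (a - b) <= 0], or [< 0] in
    the strict case; that [a - b] belongs to the domain is the inclusion
    [A - B `<=` A + R k].  A negative value yields a point of [A] from which
    [a - b] is reached along [- k], hence a core point as soon as every such
    displacement carries [A] into its core.  A nonpositive value yields
    [a - b - t *: k] in [A] for all [t > 0] when [- k] is a recession direction,
    hence [a - b] in [A] by directional closedness ([phi_le0_mem]). *)

Definition levels (R : realType) (Y : lmodType R) (A : set Y) (k y : Y) :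
    set R :=
  [set t | A (y - t *: k)].

Lemma minkowski_sub_mem (V : zmodType) (A B C : set V) (a b : V) :
  minkowski_sub A B `<=` C -> A a -> B b -> C (a - b).
Proof. by move=> sABC Aa Bb; apply: sABC; exists a => //; exists b. Qed.

Section ScalarizingFunctional.
Context (R : realType) (Y : lmodType R).
Implicit Types (A B : set Y) (k y : Y) (s t r : R) (x : \bar R).

Lemma minkowski_add_level A k y t :
  minkowski_add A [set t *: k] y <-> levels A k y t.
Proof.
rewrite /levels /=; split=> [[a Aa [_ -> <-]]|Ay]; first by rewrite addrK.
by exists (y - t *: k) => //; exists (t *: k) => //; rewrite subrK.
Qed.

Lemma phi_funE A k y : phi_fun A k y = inf_nu (levels A k y).
Proof.
congr inf_nu; apply/seteqP; split=> t /=; by move/minkowski_add_level.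
Qed.

Lemma phi_level_le A k y t : A (y - t *: k) ->
  exists2 x, phi_fun A k y = Some x & (x <= t%:E)%E.
Proof.
move=> Ayt; rewrite phi_funE /inf_nu; case: asboolP => [levels0|_].
  by have : levels A k y t by []; rewrite levels0.
by eexists; first reflexivity; apply: ereal_inf_lbound; exists t.
Qed.

Lemma phi_lt_level A k y x t : phi_fun A k y = Some x -> (x < t%:E)%E ->
  exists2 s, s < t & A (y - s *: k).
Proof.
rewrite phi_funE /inf_nu; case: asboolP => // _ [<-] /ereal_inf_lt[].
by move=> _ [s /= As <-]; rewrite lte_fin => lt_st; exists s.
Qed.

Lemma phi_ge A k y x x0 : phi_fun A k y = Some x ->
  (forall t, A (y - t *: k) -> (x0 <= t%:E)%E) -> (x0 <= x)%E.
Proof.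
rewrite phi_funE /inf_nu; case: asboolP => // _ [<-] x0_le.
by apply: le_ereal_inf_tmp => _ [t At <-]; exact: x0_le.
Qed.

Lemma phi_dom_level A k y t : A (y - t *: k) -> nu_dom (phi_fun A k) y.
Proof.
move=> /phi_level_le[[r| |] phi_y] //; rewrite /nu_dom /= phi_y.
- by left; exists r.
- by right.
Qed.

Lemma nu_dom_some A k y : nu_dom (phi_fun A k) y ->
  exists x, phi_fun A k y = Some x.
Proof. by case=> [[r]|] ->; eexists. Qed.

Lemma phi_line_dom A k y :
  minkowski_add A (scaled_by [set: R] k) y -> nu_dom (phi_fun A k) y.
Proof.
move=> [a Aa [_ [t _ <-] <-]].
by apply: (@phi_dom_level _ _ _ t); rewrite addrK.
Qed.

(** Subtracting [y2 - y1 - s *: k] from a point [y2 - t *: k] of [A] gives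
    [y1 - (t - s) *: k]: the slice of [y2], translated by [- s], lies in the
    slice of [y1].  A single estimate thus serves both the plain ([s = 0]) and
    the strict ([s > 0]) monotonicity. *)
Lemma phi_shift A B k y1 y2 s x2 : minkowski_sub A B `<=` A ->
  B (y2 - y1 - s *: k) -> nu_dom (phi_fun A k) y1 ->
  phi_fun A k y2 = Some x2 ->
  exists2 x1, phi_fun A k y1 = Some x1 & (x1 + s%:E <= x2)%E.
Proof.
move=> sABA Bs /nu_dom_some[x1 phi_y1] phi_y2; exists x1 => //.
apply: (phi_ge phi_y2) => t At.
have := minkowski_sub_mem sABA At Bs.
have -> : y2 - t *: k - (y2 - y1 - s *: k) = y1 - (t - s) *: k.
  rewrite scalerBl !opprB [LHS]addrC addrA -(addrA (s *: k)) subrK.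
  by rewrite [RHS]addrCA addrA.
by move=> /phi_level_le[x]; rewrite phi_y1 => -[<-]; rewrite EFinB leeBrDr.
Qed.

(** Directional closedness asks for a strictly decreasing null sequence; it is
    extracted from arbitrarily small admissible steps by choosing each step
    below both its predecessor and a null sequence. *)
Lemma directionally_closed_near A k y : directionally_closed k A ->
  (forall e : R, 0 < e -> exists t, 0 < t < e /\ A (y - t *: k)) -> A y.
Proof.
move=> closedA near.
have /choice[f fP] (e : R) :
    exists t, 0 < e -> 0 < t < e /\ A (y - t *: k).
  case: (ltP 0 e) => [/near[t tP]|_]; first by exists t.
  by exists 0.
pose bound := fix bound n :=
  if n is m.+1 then Num.min (f (bound m)) m.+2%:R^-1 else 1.
have bound_gt0 n : 0 < bound n.
  elim: n => [|n IHn] //=; rewrite lt_min invr_gt0 ltr0n andbT.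
  by have [/andP[]] := fP _ IHn.
have bound_le n : bound n <= n.+1%:R^-1.
  by case: n => [|n] /=; [rewrite invr1 | rewrite ge_min lexx orbT].
pose u n := f (bound n).
have u_gt0 n : 0 < u n by have [/andP[]] := fP _ (bound_gt0 n).
have u_lt n : u n < bound n by have [/andP[]] := fP _ (bound_gt0 n).
have uA n : A (y - u n *: k) by have [] := fP _ (bound_gt0 n).
apply: closedA; exists u; split=> //.
  apply/decreasing_seqP => n; apply: lt_le_trans (u_lt _) _.
  by rewrite /= ge_min lexx.
apply: (@squeeze_cvgr _ _ _ _ (fun=> 0) (@harmonic R)).
- near=> n; rewrite ltW ?u_gt0 //=.
  exact: le_trans (ltW (u_lt n)) (bound_le n).
- exact: cvg_cst.
- exact: cvg_harmonic.
Unshelve. all: by end_near. Qed.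

(** If [r] is not itself a level, the levels [s] approaching the infimum [r]
    are all strictly above it, so the differences [s - r] are arbitrarily small
    admissible steps from [y - r *: k]. *)
Lemma phi_attained A k y r : directionally_closed k A ->
  phi_fun A k y = Some r%:E -> A (y - r *: k).
Proof.
move=> closedA phi_y; case: (pselect (A (y - r *: k))) => // nAr.
apply: (directionally_closed_near closedA) => e e_gt0.
have [|s s_lt As] := phi_lt_level (t := r + e) phi_y.
  by rewrite lte_fin ltrDl.
exists (s - r); split; last by rewrite scalerBl opprB addrA subrK.
rewrite subr_gt0 ltrBlDl s_lt andbT lt_neqAle; apply/andP; split.
  by apply/eqP => rs; apply: nAr; rewrite rs.
have [x] := phi_level_le As; rewrite phi_y => -[<-].
by rewrite lee_fin.
Qed.

(** When [- k] is a recession direction the slices are upward closed, so a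
    nonpositive infimum puts every positive level in the slice. *)
Lemma phi_le0_mem A k y x : [set - u | u in recession_cone A] k ->
  directionally_closed k A ->
  phi_fun A k y = Some x -> (x <= 0)%E -> A y.
Proof.
move=> [u recu <-] closedA phi_y x_le0.
apply: (directionally_closed_near closedA) => e e_gt0.
have e2_gt0 : 0 < e / 2 by rewrite divr_gt0.
(* The infimum is only known to be [<= 0], so a level below [e / 2] exists
   and the recession direction raises it to [e / 2] itself. *)
exists (e / 2); split.
  by rewrite e2_gt0 ltr_pdivrMr // ltr_pMr // ltr1n.
have [|s s_lt As] := phi_lt_level (t := e / 2) phi_y.
  by rewrite (le_lt_trans x_le0) // lte_fin.
have := recu _ As (e / 2 - s).
rewrite subr_ge0 (ltW s_lt) => /(_ isT).
by rewrite !scalerN !opprK scalerBl addrA addrAC addrK.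
Qed.

Lemma phi_mem_le0 A k a : A a ->
  nu_dom (phi_fun A k) a /\ exists2 x, phi_fun A k a = Some x & (x <= 0)%E.
Proof.
move=> Aa; have Aa0 : A (a - 0 *: k) by rewrite scale0r subr0.
by split; [exact: phi_dom_level Aa0 | exact: phi_level_le Aa0].
Qed.

Lemma finite_valued_dom A k (F : set Y) :
  finite_valued_on (phi_fun A k) F -> F `<=` nu_dom (phi_fun A k).
Proof. by move=> finF y /finF; left. Qed.

Lemma phi_monotone A B k :
  minkowski_sub A B `<=` A -> B_monotone (phi_fun A k) B.
Proof.
move=> sABA y1 y2 dom1 /nu_dom_some[x2 phi2] By.
have [|x1 phi1] := phi_shift (s := 0) sABA _ dom1 phi2.
  by rewrite scale0r subr0.
by rewrite phi1 phi2 /= adde0.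
Qed.

Lemma phi_monotone_sub A B k : [set - u | u in recession_cone A] k ->
  directionally_closed k A ->
  minkowski_sub A B `<=` minkowski_add A (scaled_by [set: R] k) ->
  B_monotone (phi_fun A k) B -> minkowski_sub A B `<=` A.
Proof.
move=> reck closedA sABk mono y yAB; have domy := phi_line_dom (sABk y yAB).
case: yAB domy => a Aa [b Bb <-] domy.
have [doma [xa phia xa_le0]] := phi_mem_le0 k Aa.
have := mono _ _ domy doma; rewrite subKr => /(_ Bb).
have [xy phiy] := nu_dom_some domy; rewrite phia phiy /= => le_yx.
exact: (phi_le0_mem reck closedA phiy (le_trans le_yx xa_le0)).
Qed.

(** Attainment of [phi y2 = r] is essential here: it makes [y1 - r *: k] a core
    point, and the room [e] it leaves in the direction [k] is the gap
    [phi y1 <= r - e]. *)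
Lemma phi_strictly_monotone_on A B k (F : set Y) :
  directionally_closed k A -> finite_valued_on (phi_fun A k) F ->
  minkowski_sub A (B `\ 0) `<=` alg_core A ->
  strictly_B_monotone_on (phi_fun A k) B F.
Proof.
move=> closedA finF sABcore y1 y2 F1 /finF[r phi2] By.
have [_ /(_ k)[e e_gt0 coreA]] :=
  minkowski_sub_mem sABcore (phi_attained closedA phi2) By.
have := coreA e; rewrite lexx ltW //= => /(_ isT).
have -> : y2 - r *: k - (y2 - y1) + e *: k = y1 - (r - e) *: k.
  by rewrite scalerBl !opprB [S in S + _]addrC addrA subrK [RHS]addrA addrAC.
move=> /phi_level_le[x1 phi1 x1_le]; rewrite phi1 phi2 /=.
by apply: le_lt_trans x1_le _; rewrite lte_fin ltrBlDr ltrDl.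
Qed.

(** A strict inequality produces a negative level [t] of [a - b]; then [a - b]
    is the point [a - b - t *: k] of [A] displaced by [(- t) *: k] in the
    negative direction, with [- t > 0]. *)
Lemma phi_strictly_monotone_sub_core A B k :
  minkowski_sub A (scaled_by [set t : R | 0 < t] k) `<=` alg_core A ->
  minkowski_sub A B `<=` minkowski_add A (scaled_by [set: R] k) ->
  strictly_B_monotone (phi_fun A k) B ->
  minkowski_sub A (B `\ 0) `<=` alg_core A.
Proof.
move=> sAkcore sABk mono _ [a Aa [b Bb <-]].
have domy := phi_line_dom (minkowski_sub_mem sABk Aa Bb.1).
have [doma [xa phia xa_le0]] := phi_mem_le0 k Aa.
have := mono _ _ domy doma; rewrite subKr => /(_ Bb).
have [xy phiy] := nu_dom_some domy; rewrite phia phiy /= => lt_yx.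
have [t t_lt0 At] := phi_lt_level phiy (lt_le_trans lt_yx xa_le0).
have <- : a - b - t *: k - (- t) *: k = a - b by rewrite scaleNr opprK subrK.
apply: (minkowski_sub_mem sAkcore At).
by exists (- t) => //=; rewrite oppr_gt0.
Qed.

(** The core of [B] is probed in the direction [- k] because a decrease of
    the levels of [y1] relative to those of [y2] corresponds to
    [y2 - y1 - e *: k] being in [B].  Finiteness matters at the end: a gain of
    [e] is strict only for real values. *)
Lemma phi_strictly_core_monotone_on A B k (F : set Y) :
  finite_valued_on (phi_fun A k) F -> minkowski_sub A B `<=` A ->
  strictly_B_monotone_on (phi_fun A k) (alg_core B) F.
Proof.
move=> finF sABA y1 y2 F1 F2 [[_ /(_ (- k))[e e_gt0 coreB]] _].
have := coreB e; rewrite lexx ltW //= scalerN => /(_ isT) Be.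
have [r phi2] := finF _ F2.
have [x1 phi1 x1_le] := phi_shift sABA Be (finite_valued_dom finF F1) phi2.
have [r1 phi1r] := finF _ F1.
move: phi1 x1_le; rewrite phi1r => -[<-]; rewrite phi2 /= !(lee_fin, lte_fin).
by apply: lt_le_trans; rewrite ltrDl.
Qed.

End ScalarizingFunctional.

Theorem theorem4 (R : realType) (Y : lmodType R) (A : set Y) (k : Y)
    (B : set Y) (A_neq0 : A !=set0) (k_neq0 : k != 0) :
  (minkowski_sub A B `<=` A -> B_monotone (phi_fun A k) B) /\
  (([set - u | u in recession_cone A] k ->
    directionally_closed k A ->
    minkowski_sub A B `<=` minkowski_add A (scaled_by [set: R] k) ->
    (B_monotone (phi_fun A k) B <-> minkowski_sub A B `<=` A)) /\
  ((forall F : set Y,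
    directionally_closed k A ->
    finite_valued_on (phi_fun A k) F ->
    minkowski_sub A (B `\ 0) `<=` alg_core A ->
    strictly_B_monotone_on (phi_fun A k) B F) /\
  ((minkowski_sub A (scaled_by [set t : R | 0 < t] k) `<=` alg_core A ->
    minkowski_sub A B `<=` minkowski_add A (scaled_by [set: R] k) ->
    strictly_B_monotone (phi_fun A k) B ->
    minkowski_sub A (B `\ 0) `<=` alg_core A) /\
  (forall F : set Y,
    finite_valued_on (phi_fun A k) F ->
    minkowski_sub A B `<=` A ->
    strictly_B_monotone_on (phi_fun A k) (alg_core B) F)))).
Proof.
split; first exact: phi_monotone.
split.
  move=> reck closedA sABk; split; last exact: phi_monotone.
  exact: phi_monotone_sub.
split; first by move=> F; exact: phi_strictly_monotone_on.
split; first exact: phi_strictly_monotone_sub_core.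
by move=> F; exact: phi_strictly_core_monotone_on.
Qed.
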